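(* Let $q\geqslant2$ be an even integer, $n\geqslant1$, and let $f,g,s:\mathbb{F}_2^n\to\mathbb{Z}_q$. Let $h:\mathbb{F}_2\times\mathbb{F}_2\times\mathbb{F}_2^n\to\mathbb{Z}_q$ be defined by $h(z,y,x)=f(x)+(y\oplus z)g(x)+yz\,s(x)$, and suppose $h$ is a generalized bent function. Then $h$ is self-dual if and only if $f$ is a regular generalized bent function, $g=\widetilde f+(q-1)f$, and $s(x)=q/2$ for all $x\in\mathbb{F}_2^n$.
   Context: In the formula for $h$, $y\oplus z$ and $yz$ are elements of $\{0,1\}$ treated as integers. Functions on $\mathbb{F}_2\times\mathbb{F}_2\times\mathbb{F}_2^n$ are identified with functions on $\mathbb{F}_2^{n+2}$. With $\omega=e^{2\pi i/q}$, for $f:\mathbb{F}_2^m\to\mathbb{Z}_q$, $H_f(u)=\sum_x\omega^{f(x)}(-1)^{\langle x,u\rangle}$; $f$ is generalized bent if $|H_f(u)|=2^{m/2}$ for all $u$, regular with dual $\widetilde f$ if $H_f(u)=2^{m/2}\omega^{\widetilde f(u)}$ for all $u$, and self-dual if it is regular with $\widetilde f=f$. *)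

(* Defs.v *)
From mathcomp Require Import all_boot all_order all_algebra.
From mathcomp Require Import complex.
From mathcomp Require Import reals exp trigo.

Set Implicit Arguments.
Unset Strict Implicit.
Unset Printing Implicit Defensive.

Import Order.TTheory GRing.Theory Num.Theory.
Local Open Scope ring_scope.
Local Open Scope complex_scope.

Definition omega (R : realType) (q : nat) : R[i] :=
  cos (2 * pi / q%:R) +i* sin (2 * pi / q%:R).

Definition dotp (m : nat) (x u : 'rV['F_2]_m) : 'F_2 := \sum_(i < m) x 0 i * u 0 i.

(* Elements of 'Z_q and 'F_2 are coerced to their least natural
   representatives when used as exponents. *)
Definition gWalsh (R : realType) (q m : nat) (f : 'rV['F_2]_m -> 'Z_q)
    (u : 'rV['F_2]_m) : R[i] :=
  \sum_(x : 'rV['F_2]_m) omega R q ^+ f x * (-1) ^+ dotp x u.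

Definition gbent (R : realType) (q m : nat) (f : 'rV['F_2]_m -> 'Z_q) : Prop :=
  forall u, `|gWalsh R f u| = (2 `^ (m%:R / 2))%:C.

Definition regular_with_dual (R : realType) (q m : nat)
    (f fd : 'rV['F_2]_m -> 'Z_q) : Prop :=
  forall u, gWalsh R f u = (2 `^ (m%:R / 2))%:C * omega R q ^+ fd u.

Definition self_dual (R : realType) (q m : nat) (f : 'rV['F_2]_m -> 'Z_q) : Prop :=
  regular_with_dual R f f.

(* A function of (z, y, x) read as a function of the concatenated vector;
   1 + (1 + n) is convertible to n.+2. *)
Definition on_vec (n : nat) (T : Type) (h : 'F_2 * 'F_2 * 'rV['F_2]_n -> T)
    (v : 'rV['F_2]_(1 + (1 + n))) : T :=
  h (lsubmx v 0 0, lsubmx (rsubmx v) 0 0, rsubmx (rsubmx v)).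

(* Main.v *)
(* Writing A, B, E for the transforms of f, f + g and f + s, the transform of h
   at (a, b, w) is A + ((-1)^a + (-1)^b) B + (-1)^(a + b) E at w. Hence h is
   self-dual iff, with N = 2^(n/2),
     A + 2B + E = 2N omega^f,  A - E = 2N omega^(f+g),
     A - 2B + E = 2N omega^(f+s).
   Subtracting the outer equations gives 2B = N omega^f (1 - omega^s). Parseval
   for B then forces |1 - omega^s| to take its maximal value 2 everywhere, that
   is omega^s = -1, and the system reduces to A = N omega^(f+g). Conversely, if
   omega^s = -1 and A = N omega^(f+g), then E = -A, and B = N omega^f because
   the transform is an involution up to the factor N^2. *)
Require Import Defs.
From mathcomp Require Import all_boot all_order all_algebra.
From mathcomp Require Import complex.
From mathcomp Require Import reals exp trigo.
From mathcomp Require Import ring lra.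

Set Implicit Arguments.
Unset Strict Implicit.
Unset Printing Implicit Defensive.

Import Order.TTheory GRing.Theory Num.Theory.
Local Open Scope ring_scope.
Local Open Scope complex_scope.

(** * Signs and dot products over F_2 *)

Lemma signF2D (K : pzRingType) (a b : 'F_2) :
  (-1) ^+ (a + b)%R = (-1) ^+ a * (-1) ^+ b :> K.
(* The sum [a + b] is reduced modulo 2, and a sign depends only on parity. *)
Proof. by rewrite -exprD -[RHS]signr_odd -modn2. Qed.

Lemma sumF2 (V : nmodType) (F : 'F_2 -> V) : \sum_z F z = F 0 + F 1.
Proof.
rewrite (bigD1 0) // (bigD1 1) //= big1 ?addr0 // => i.
by case: i => -[|[|]].
Qed.

Lemma F2_neq0 (a : 'F_2) : a != 0 -> a = 1.
Proof. by case: a => -[|[|//]] i // _; apply: val_inj. Qed.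

Section DotProduct.
Variable m : nat.
Implicit Types x u : 'rV['F_2]_m.

Lemma dotpC x u : dotp x u = dotp u x.
Proof. by apply: eq_bigr => i _; rewrite mulrC. Qed.

Lemma dotpDr x u v : dotp x (u + v) = dotp x u + dotp x v.
Proof. by rewrite -big_split; apply: eq_bigr => i _; rewrite mxE mulrDr. Qed.

Lemma dotp_delta x i : dotp x (delta_mx 0 i) = x 0 i.
Proof.
rewrite /dotp (bigD1 i) //= mxE !eqxx mulr1 big1 ?addr0 // => j /negPf ji.
by rewrite mxE ji mulr0.
Qed.

Lemma dotp_row_mx k (x1 u1 : 'rV['F_2]_k) x u :
  dotp (row_mx x1 x) (row_mx u1 u) = dotp x1 u1 + dotp x u.
Proof.
rewrite /dotp big_split_ord; congr (_ + _); apply: eq_bigr => i _.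
  by rewrite !row_mxEl.
by rewrite !row_mxEr.
Qed.

End DotProduct.

Lemma dotp_scalar (a b : 'F_2) : dotp a%:M b%:M = a * b.
Proof. by rewrite /dotp big_ord1 !mxE !mulr1n. Qed.

(** * Walsh transform: inversion and Parseval *)

Section WalshTransform.
Variables (C : numClosedFieldType) (m : nat).
Implicit Types (a : 'rV['F_2]_m -> C) (x u : 'rV['F_2]_m).

Definition walsh a u : C := \sum_x a x * (-1) ^+ dotp x u.

Lemma eq_walsh a b : a =1 b -> walsh a =1 walsh b.
Proof. by move=> ab u; apply: eq_bigr => x _; rewrite ab. Qed.

Lemma walshZ c a u : walsh (fun x => c * a x) u = c * walsh a u.
Proof. by rewrite mulr_sumr; apply: eq_bigr => x _; rewrite mulrA. Qed.

Lemma sum_sign_dotp x : \sum_u (-1) ^+ dotp x u = (x == 0)%:R * 2 ^+ m :> C.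
Proof.
have [->|/rV0Pn[i /F2_neq0 xi]] := eqVneq x 0.
  rewrite mul1r (eq_bigr (fun=> 1)) => [|u _]; last first.
    by rewrite /dotp big1 // => i _; rewrite mxE mul0r.
  by rewrite sumr_const card_mx card_Fp // mul1n natrX.
(* translation by the i-th basis vector permutes the terms up to a sign *)
rewrite mul0r; set S := \sum_u _.
suff S_opp : S = - S.
  by apply/eqP; rewrite -[_ == 0](mulrn_eq0 _ 2) mulr2n {1}S_opp addNr.
rewrite {1}/S (reindex_inj (addIr (delta_mx 0 i))) -sumrN /=.
by apply: eq_bigr => u _; rewrite dotpDr signF2D dotp_delta xi expr1 mulrN1.
Qed.

(** After exchanging the sums, the inner one is a character sum at [x + u]; since [u + u = 0], only
    [x = u] survives. *)
Lemma walshK a u : walsh (walsh a) u = 2 ^+ m * a u.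
Proof.
rewrite /walsh; under eq_bigr do rewrite mulr_suml.
rewrite exchange_big /=.
have sum_y x : \sum_y a x * (-1) ^+ dotp x y * (-1) ^+ dotp y u
    = a x * ((x + u == 0)%:R * 2 ^+ m).
  rewrite -sum_sign_dotp mulr_sumr; apply: eq_bigr => y _.
  by rewrite -mulrA -signF2D (dotpC x) -dotpDr dotpC.
have F2_addrr : u + u = 0.
  by apply/rowP => i; rewrite !mxE -mulr2n -mulr_natr pchar_Zp ?mulr0.
under eq_bigr do rewrite sum_y.
rewrite (bigD1 u) //= big1 => [|x xu].
  by rewrite F2_addrr eqxx mul1r addr0 mulrC.
by rewrite -[X in _ == X]F2_addrr (inj_eq (addIr u)) (negPf xu) mul0r mulr0.
Qed.

(** The kernel is real and symmetric, so one transform moves across the inner product and [walshK]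
    applies. *)
Lemma parseval a : \sum_u `|walsh a u| ^+ 2 = 2 ^+ m * \sum_x `|a x| ^+ 2.
Proof.
transitivity (\sum_x (a x)^* * walsh (walsh a) x); last first.
  rewrite mulr_sumr; apply: eq_bigr => x _.
  by rewrite walshK normCK mulrCA (mulrC (a x)).
under [RHS]eq_bigr do rewrite mulr_sumr.
rewrite exchange_big; apply: eq_bigr => u _ /=.
rewrite normCK rmorph_sum mulr_sumr; apply: eq_bigr => x _.
by rewrite rmorphM rmorph_sign dotpC mulrCA.
Qed.

(** * Solving the self-duality system *)

Variables (N : C) (F G S : 'rV['F_2]_m -> C).
Hypotheses (N_ge0 : 0 <= N) (N_sqr : N ^+ 2 = 2 ^+ m).
Local Notation A := (walsh F).
Local Notation B := (walsh (fun x => F x * G x)).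
Local Notation E := (walsh (fun x => F x * S x)).

Definition self_dual_equations := forall w,
  [/\ A w + 2 * B w + E w = 2 * N * F w,
      A w - E w = 2 * N * (F w * G w)
    & A w - 2 * B w + E w = 2 * N * (F w * S w)].

Lemma self_dual_equationsP :
  (forall x, `|F x| = 1) -> (forall x, `|G x| = 1) -> (forall x, `|S x| = 1) ->
  self_dual_equations <->
  forall w, S w = -1 /\ A w = N * (F w * G w).
Proof.
move=> F1 G1 S1; have N_neq0 : N != 0.
  by rewrite -sqrf_eq0 N_sqr expf_neq0 // pnatr_eq0.
split=> [eqs | SA w]; last first.
  have [Sw Aw] := SA w.
  have Ew : E w = - A w.
    by rewrite -mulN1r -walshZ; apply: eq_walsh => x; rewrite (SA x).1 mulrC.
  have Bw : B w = N * F w.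
    (* Transforming [A = N F G] once more and inverting gives [N * B w = N ^+ 2 * F w]. *)
    apply: (mulfI N_neq0).
    rewrite mulrA -expr2 N_sqr -walshK -walshZ.
    by apply: eq_walsh => x; rewrite -(SA x).2.
  by rewrite Ew Bw Aw Sw; split; ring.
have two_neq0 : 2 != 0 :> C by rewrite pnatr_eq0.
have Bw w : 2 * B w = N * F w * (1 - S w).
  apply: (mulfI two_neq0); have [e1 _ e2] := eqs w.
  transitivity ((A w + 2 * B w + E w) - (A w - 2 * B w + E w)); first by ring.
  by rewrite e1 e2; ring.
have unit_conj z : `|z| = 1 -> z * z^* = 1 :> C.
  by move=> z1; rewrite -normCK z1 expr1n.
have normB w : 4 * `|B w| ^+ 2 = N ^+ 2 * `|1 - S w| ^+ 2.
  transitivity ((2 * B w) * (2 * B w)^*).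
    by rewrite normCK [in RHS]rmorphM rmorph_nat; ring.
  rewrite Bw normCK !rmorphM /= (geC0_conj N_ge0).
  by rewrite -[in RHS](mul1r (N ^+ 2)) -(unit_conj _ (F1 w)); ring.
(* Parallelogram law for the unit complex numbers 1 and [S w]. *)
have norm1S w : `|1 + S w| ^+ 2 = 4 - `|1 - S w| ^+ 2.
  have -> : 4 = 2 + 2 * (S w * (S w)^*) :> C.
    by rewrite (unit_conj _ (S1 w)); ring.
  by rewrite !normCK rmorphD rmorphB rmorph1; ring.
have sumB : \sum_w `|B w| ^+ 2 = N ^+ 2 * \sum_(w : 'rV['F_2]_m) 1.
  rewrite parseval N_sqr; congr (_ * _); apply: eq_bigr => x _.
  rewrite normCK rmorphM mulrACA.
  by rewrite (unit_conj _ (F1 x)) (unit_conj _ (G1 x)) mulr1.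
have S_N1 w : S w = -1.
  (* By [norm1S] and [normB], [N ^+ 2] times this sum is 4 times a difference that [sumB] makes
     zero; its nonnegative terms then all vanish. *)
  have sum0 : \sum_w `|1 + S w| ^+ 2 = 0.
    apply: (mulfI (expf_neq0 2 N_neq0)); rewrite mulr0 mulr_sumr.
    transitivity (4 * (N ^+ 2 * (\sum_(w : 'rV['F_2]_m) 1)
                       - \sum_w `|B w| ^+ 2)).
      rewrite [N ^+ 2 * _]mulr_sumr -sumrB mulr_sumr; apply: eq_bigr => x _.
      by rewrite norm1S mulrBr -normB; ring.
    by rewrite sumB subrr mulr0.
  have /eqP := sum0; rewrite psumr_eq0 => [|x _]; last exact: exprn_ge0.
  move=> /allP/(_ w (mem_index_enum _))/=.
  by rewrite sqrf_eq0 normr_eq0 addrC addr_eq0 => /eqP.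
move=> w; split=> //; have [e1 e2 e3] := eqs w.
(* This combination eliminates [B] and [E]; once [S w = -1], the outer right-hand sides cancel. *)
have Aw : 4 * A w
    = (A w + 2 * B w + E w) + (A w - 2 * B w + E w) + 2 * (A w - E w).
  by ring.
have four_neq0 : 4 != 0 :> C by rewrite pnatr_eq0.
by apply: (mulfI four_neq0); rewrite Aw e1 e2 e3 S_N1; ring.
Qed.

End WalshTransform.

(** * Powers of omega and residues modulo q *)

Section RootsOfUnity.
Variable R : realType.

(** De Moivre's formula. *)
Lemma omegaX q k :
  omega R q ^+ k = cos (2 * pi / q%:R *+ k) +i* sin (2 * pi / q%:R *+ k).
Proof.
rewrite /omega; move: (_ / _) => t.
elim: k => [|k IHk]; first by rewrite expr0 mulr0n cos0 sin0.
rewrite exprS IHk mulrS cosD sinD.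
by apply/eqP; rewrite eq_complex /= eqxx addrC eqxx.
Qed.

Lemma omega_expn q : (0 < q)%N -> omega R q ^+ q = 1.
Proof.
move=> q_gt0; rewrite omegaX -[X in cos X]mulr_natr -[X in sin X]mulr_natr.
rewrite divfK ?pnatr_eq0 -?lt0n //.
by rewrite mulr_natl -[pi *+ 2]add0r cosD2pi sinD2pi cos0 sin0.
Qed.

Lemma omega_half p : omega R p.+1.*2 ^+ p.+1 = -1.
Proof.
rewrite omegaX -[X in cos X]mulr_natr -[X in sin X]mulr_natr.
have -> : 2 * pi / p.+1.*2%:R * p.+1%:R = pi :> R.
  rewrite -mul2n natrM.
  have : p.+1%:R != 0 :> R by rewrite pnatr_eq0.
  by move: (p.+1%:R : R) => t t0; field.
rewrite cospi sinpi -[LHS]opprK; apply/eqP.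
by rewrite eq_complex /= !opprK !oppr0 !eqxx.
Qed.

Lemma norm_omega q : `|omega R q| = 1.
Proof. by rewrite normc_def /= cos2Dsin2 sqrtr1. Qed.

(** The angle [t] lies in [0, 2 pi). Cosine excludes 0, and the sign of sine excludes both (0, pi)
    and (pi, 2 pi), so [t = pi]. *)
Lemma omegaX_eqN1 q k : (k < q)%N -> omega R q ^+ k = -1 -> k.*2 = q.
Proof.
move=> kq; rewrite omegaX => /eqP; rewrite eq_complex /= oppr0 => /andP[].
set t := _ *+ k => /eqP cos_t /eqP sin_t.
have q_gt0 : 0 < q%:R :> R by rewrite ltr0n (leq_ltn_trans _ kq).
have pi_gt0 := pi_gt0 R.
have tE : t * q%:R = k.*2%:R * pi.
  rewrite /t -mulr_natr -mul2n natrM.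
  by field; rewrite gt_eqF.
have t_lt : t < 2 * pi.
  rewrite -(ltr_pM2r q_gt0) tE -mul2n natrM -!mulrA ltr_pM2l //.
  by rewrite mulrC ltr_pM2l // ltr_nat.
have t_ge0 : 0 <= t by rewrite -(pmulr_lge0 _ q_gt0) tE mulr_ge0 // ltW.
suff t_pi : t = pi.
  move: tE; rewrite t_pi mulrC => /(mulIf (lt0r_neq0 pi_gt0))/eqP.
  by rewrite eqr_nat => /eqP.
have [t_pos|t_npos] := ltP 0 t; last first.
  move: cos_t; have -> : t = 0 by apply/le_anti; rewrite t_npos.
  by rewrite cos0 => ?; lra.
have [t_pi|t_pi|//] := ltgtP t pi.
  by have := @sin_gt0_pi _ t; rewrite sin_t t_pos t_pi ltxx => /(_ isT).
have : 0 < sin (t - pi) by apply: sin_gt0_pi; apply/andP; split; lra.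
by rewrite sinB cospi sinpi sin_t mul0r mulr0 subr0 ltxx.
Qed.

End RootsOfUnity.

Lemma mulr_Zp0 q (a : 'Z_q) : (1 < q)%N -> a *+ q = 0.
Proof. by move=> q_gt1; rewrite -mulr_natr pchar_Zp ?mulr0. Qed.

Section OmegaZp.
Variables (R : realType) (q : nat).
Hypothesis q_gt1 : (1 < q)%N.

Lemma omega_modn k : omega R q ^+ (k %% q) = omega R q ^+ k.
Proof. by rewrite expr_mod // omega_expn // ltnW. Qed.

Lemma omegaZpD (a b : 'Z_q) :
  omega R q ^+ (a + b)%R = omega R q ^+ a * omega R q ^+ b.
(* The modulus of ['Z_q] is [q] itself only when [1 < q], hence the use of [Zp_cast]. *)
Proof. by rewrite /= [X in (_ %% X)%N]Zp_cast // omega_modn exprD. Qed.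

Lemma omegaZp_nat k : omega R q ^+ (k%:R : 'Z_q) = omega R q ^+ k.
Proof. by rewrite val_Zp_nat // omega_modn. Qed.

Lemma omegaZp_eqN1 (a : 'Z_q) : ~~ odd q ->
  omega R q ^+ a = -1 <-> a = (q %/ 2)%:R.
Proof.
move=> q_even; have qE : (q./2).*2 = q by rewrite even_halfK.
rewrite divn2; split=> [|->].
  have a_lt : (a < q)%N by have := ltn_ord a; rewrite [X in (_ < X)%N]Zp_cast.
  by move=> /(omegaX_eqN1 a_lt)/(congr1 half) <-; rewrite doubleK natr_Zp.
rewrite omegaZp_nat -{1}qE.
have : (0 < q./2)%N by rewrite half_gt0.
by case: q./2 => // p _; apply: omega_half.
Qed.

End OmegaZp.

(** * The modulus 2^(m/2) *)

Section Scale.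
Variable R : realType.

Definition bent_norm m : R[i] := (2 `^ (m%:R / 2))%:C.

Lemma bent_norm_ge0 m : 0 <= bent_norm m.
Proof. by rewrite /bent_norm ler0c powR_ge0. Qed.

Lemma bent_norm_sqr m : bent_norm m ^+ 2 = 2 ^+ m.
Proof.
rewrite /bent_norm -rmorphXn -powR_mulrn ?powR_ge0 //.
by rewrite -powRrM divfK ?pnatr_eq0 // powR_mulrn // rmorphXn rmorph_nat.
Qed.

(** The source of the factor 2N in the equations: [h] has two more variables than [f]. *)
Lemma bent_normSS m : bent_norm m.+2 = 2 * bent_norm m.
Proof.
rewrite /bent_norm -[m.+2]addn2 natrD mulrDl divff ?pnatr_eq0 //.
rewrite powRD ?pnatr_eq0 ?implybT //.
by rewrite powRr1 // rmorphM mulrC rmorph_nat.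
Qed.
End Scale.

Lemma gWalshE (R : realType) q m (f : 'rV['F_2]_m -> 'Z_q) :
  gWalsh R f =1 walsh (fun x => omega R q ^+ f x).
Proof. by []. Qed.

(** * Splitting off the two extra coordinates *)

Lemma sum_vecSS (V : nmodType) n (F : 'rV['F_2]_(1 + (1 + n)) -> V) :
  \sum_v F v = \sum_z \sum_y \sum_x F (row_mx z%:M (row_mx y%:M x)).
Proof.
rewrite pair_big pair_big /=.
rewrite (reindex (fun p : 'F_2 * 'F_2 * 'rV['F_2]_n =>
   row_mx p.1.1%:M (row_mx p.1.2%:M p.2))) //=.
exists (fun v => (lsubmx v 0 0, lsubmx (rsubmx v) 0 0, rsubmx (rsubmx v))).
  by move=> [[z y] x] _ /=; rewrite !row_mxKr !row_mxKl !mxE !mulr1n.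
by move=> v _ /=; rewrite -!mx11_scalar !hsubmxK.
Qed.

Lemma on_vecE n T (h : 'F_2 * 'F_2 * 'rV['F_2]_n -> T) z y x :
  on_vec h (row_mx z%:M (row_mx y%:M x)) = h (z, y, x).
Proof. by rewrite /on_vec !row_mxKr !row_mxKl !mxE !mulr1n. Qed.

Lemma rV_F2_split n (v : 'rV['F_2]_(1 + (1 + n))) :
  exists z y x, v = row_mx z%:M (row_mx y%:M x).
Proof.
exists (lsubmx v 0 0), (lsubmx (rsubmx v) 0 0), (rsubmx (rsubmx v)).
by rewrite -!mx11_scalar !hsubmxK.
Qed.

(** * Self-duality of h as a system of equations *)

Section SelfDual.
Variables (R : realType) (q n : nat).
Hypothesis q_gt1 : (1 < q)%N.
Variables (f g s : 'rV['F_2]_n -> 'Z_q) (h : 'F_2 * 'F_2 * 'rV['F_2]_n -> 'Z_q).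
Hypothesis h_def : forall (z y : 'F_2) (x : 'rV['F_2]_n),
  h (z, y, x) = f x + g x *+ (y + z : 'F_2)%R + s x *+ (y * z : 'F_2)%R.

Let F x := omega R q ^+ f x.
Let G x := omega R q ^+ g x.
Let S x := omega R q ^+ s x.

Let h00 x : omega R q ^+ h (0, 0, x) = F x.
Proof.
by have -> : h (0, 0, x) = f x by rewrite h_def -[RHS]addr0 -[RHS]addr0.
Qed.

Let h01 x : omega R q ^+ h (0, 1, x) = F x * G x.
Proof.
rewrite -omegaZpD //.
by have -> : h (0, 1, x) = f x + g x by rewrite h_def -[RHS]addr0.
Qed.

Let h10 x : omega R q ^+ h (1, 0, x) = F x * G x.
Proof.
rewrite -omegaZpD //.
by have -> : h (1, 0, x) = f x + g x by rewrite h_def -[RHS]addr0.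
Qed.

(** In F_2, [1 + 1] is 0, so the multiple of [g x] disappears. *)
Let h11 x : omega R q ^+ h (1, 1, x) = F x * S x.
Proof.
rewrite -omegaZpD //.
by have -> : h (1, 1, x) = f x + s x by rewrite h_def -[f x in RHS]addr0.
Qed.

(** Each block (z, y) contributes its own transform with sign (-1)^(za + yb); the two mixed blocks
    share [F x * G x]. *)
Lemma gWalsh_on_vec a b w :
  gWalsh R (on_vec h) (row_mx a%:M (row_mx b%:M w)) =
  walsh F w + ((-1) ^+ a + (-1) ^+ b) * walsh (fun x => F x * G x) w
  + (-1) ^+ a * (-1) ^+ b * walsh (fun x => F x * S x) w.
Proof.
have term z y (W : 'rV['F_2]_n -> R[i]) :
    (forall x, omega R q ^+ h (z, y, x) = W x) ->
    \sum_x omega R q ^+ on_vec h (row_mx z%:M (row_mx y%:M x)) *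
     (-1) ^+ dotp (row_mx z%:M (row_mx y%:M x)) (row_mx a%:M (row_mx b%:M w))
    = (-1) ^+ (z * a)%R * (-1) ^+ (y * b)%R * walsh W w.
  move=> hW; rewrite mulr_sumr; apply: eq_bigr => x _.
  by rewrite on_vecE !dotp_row_mx !dotp_scalar !signF2D hW; ring.
rewrite /gWalsh sum_vecSS !sumF2.
rewrite (term 0 0 _ h00) (term 0 1 _ h01) (term 1 0 _ h10) (term 1 1 _ h11).
by rewrite !mul0r !mul1r !expr0; ring.
Qed.

(** Three equations cover the four pairs (a, b), as (0, 1) and (1, 0) give the same one. *)
Lemma self_dual_on_vec :
  self_dual R (on_vec h) <-> self_dual_equations (bent_norm R n) F G S.
Proof.
split=> [sd w | eqs v].
  have e a b : gWalsh R (on_vec h) (row_mx a%:M (row_mx b%:M w))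
      = 2 * bent_norm R n * omega R q ^+ h (a, b, w).
    by rewrite sd on_vecE -bent_normSS.
  have := e 0 0; have := e 0 1; have := e 1 1.
  rewrite !gWalsh_on_vec h00 h01 h11 !expr0 !expr1 => e11 e01 e00.
  by split; [rewrite -e00 | rewrite -e01 | rewrite -e11]; ring.
have [a [b [w ->]]] := rV_F2_split v.
rewrite gWalsh_on_vec on_vecE.
have -> : (2 `^ ((1 + (1 + n))%:R / 2))%:C = 2 * bent_norm R n.
  by rewrite -bent_normSS.
have [e1 e2 e3] := eqs w.
have [->|/F2_neq0->] := eqVneq a 0; have [->|/F2_neq0->] := eqVneq b 0.
- by rewrite h00 -e1 !expr0; ring.
- by rewrite h01 -e2 !expr0 !expr1; ring.
- by rewrite h10 -e2 !expr0 !expr1; ring.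
- by rewrite h11 -e3 !expr1; ring.
Qed.

End SelfDual.

Theorem theorem6 (R : realType) (q n : nat)
    (hq : (2 <= q)%N) (q_even : ~~ odd q) (hn : (1 <= n)%N)
    (f g s : 'rV['F_2]_n -> 'Z_q)
    (h : 'F_2 * 'F_2 * 'rV['F_2]_n -> 'Z_q)
    (h_def : forall (z y : 'F_2) (x : 'rV['F_2]_n),
       h (z, y, x) = f x + g x *+ (y + z : 'F_2)%R + s x *+ (y * z : 'F_2)%R)
    (h_gbent : gbent R (on_vec h)) :
  self_dual R (on_vec h) <->
  exists fd : 'rV['F_2]_n -> 'Z_q,
    [/\ gbent R f, regular_with_dual R f fd,
        (forall x, g x = fd x + f x *+ (q - 1)%N)
      & (forall x, s x = (q %/ 2)%N%:R)].
Proof.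
rewrite (self_dual_on_vec R hq h_def) self_dual_equationsP; last 5 first.
- exact: bent_norm_ge0.
- exact: bent_norm_sqr.
- by move=> x; rewrite normrX norm_omega expr1n.
- by move=> x; rewrite normrX norm_omega expr1n.
- by move=> x; rewrite normrX norm_omega expr1n.
(* Thus (q - 1)f = -f, and the condition on [g] says that the dual of [f] is f + g. *)
have f_pred x : f x + f x *+ (q - 1) = 0.
  by rewrite -mulrS subn1 prednK ?mulr_Zp0 // ltnW.
split=> [SA | [fd [_ f_fd g_fd s_half]] w].
  (* The equation [A = N F G] is regularity of [f] with dual f + g; bentness follows because powers
     of omega have modulus 1. *)
  have f_dual : regular_with_dual R f (fun x => f x + g x).
    by move=> u; rewrite omegaZpD // gWalshE (SA u).2.
  exists (fun x => f x + g x); split=> // x.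
  - rewrite f_dual normrM normrX norm_omega expr1n mulr1.
    exact: ger0_norm (bent_norm_ge0 R n).
  - by rewrite addrAC f_pred add0r.
  by apply/(omegaZp_eqN1 R hq _ q_even); case: (SA x).
split; first exact/(omegaZp_eqN1 R hq _ q_even).
rewrite -omegaZpD // -gWalshE f_fd; congr (_ * _ ^+ _).
by rewrite g_fd addrCA f_pred addr0.
Qed.
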